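(* Let $H$ be a real separable Hilbert space, $d\in\mathbb N$, $d\ge1$, $\dim H\ge d$, and let $\mu$ be an arbitrary Borel probability measure on $H$ with bounded support. Then $$\int_{H^{d+2}} c_{\mathrm{dls}}^2(X)\,d\mu^{d+2}(X)\le e_2^2(\mu,d).$$
   Context: $\mathrm{AG}_d(H)$ is the set of $d$-dimensional affine subspaces of $H$, and $e_2(\mu,d)=\inf_{L\in\mathrm{AG}_d(H)}\sqrt{\int\operatorname{dist}^2(x,L)\,d\mu(x)}$. For $X=(x_0,\dots,x_{d+1})\in H^{d+2}$, $$c_{\mathrm{dls}}(X)=\min_{L\in\mathrm{AG}_d(H)}\sqrt{\frac{\sum_{i=0}^{d+1}\operatorname{dist}^2(x_i,L)}{d+2}}.$$ *)

(* Defs.v *)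
From HB Require Import structures.
From mathcomp Require Import all_boot all_order all_algebra.
From mathcomp Require Import all_classical all_reals all_analysis.

Set Implicit Arguments.
Unset Strict Implicit.
Unset Printing Implicit Defensive.

Import Order.TTheory GRing.Theory Num.Theory.
Import numFieldNormedType.Exports.

Local Open Scope classical_set_scope.
Local Open Scope ring_scope.

Notation borel T := (g_sigma_algebraType (@open T)).

Definition separable (T : topologicalType) : Prop :=
  exists2 D : set T, countable D & dense D.

Definition support_of (R : realType) (T : ptopologicalType)
    (mu : {measure set (borel T) -> \bar R}) : set T :=
  [set x | forall U : set T, open U -> U x -> (0 < mu U)%E].

Section power_measure.
Context d (T : measurableType d) (R : realType).

Definition cons_pair n (p : T * n.-tuple T) : n.+1.-tuple T :=
  [tuple of p.1 :: p.2].

Let measurable_cons_pair n : measurable_fun setT (@cons_pair n).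
Proof. exact: measurable_cons measurable_fst measurable_snd. Qed.

HB.instance Definition _ n :=
  @isMeasurableFun.Build _ _ (T * n.-tuple T)%type (n.+1.-tuple T)
    (@cons_pair n) (@measurable_cons_pair n).

(* The n-fold product of P, on n.-tuple T with the product sigma-algebra: the
   image of P \x (P to the power n - 1) by the bijection
   T * T ^ (n - 1) -> T ^ n; see power_measure_box for the characterization. *)
Fixpoint power_measure (P : probability T R) (n : nat) :
    probability (n.-tuple T) R :=
  match n return probability (n.-tuple T) R with
  | 0 => dirac [tuple]
  | m.+1 => distribution (P \x power_measure P m)%E (@cons_pair m)
  end.

Lemma power_measure_box (P : probability T R) n (A : 'I_n -> set T) :
  (forall i, measurable (A i)) ->
  power_measure P n [set X | forall i, A i (tnth X i)] =
  (\prod_(i < n) P (A i))%E.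
Proof.
elim: n A => [|n IHn] A mA.
  rewrite big_ord0 /= /dirac indicE mem_set//.
  by case.
have mbox m (B : 'I_m -> set T) : (forall i, measurable (B i)) ->
    measurable [set X : m.-tuple T | forall i, B i (tnth X i)].
  move=> mB.
  have -> : [set X : m.-tuple T | forall i, B i (tnth X i)] =
      \big[setI/setT]_(i < m) ((@tnth m T)^~ i @^-1` B i).
    rewrite -bigcap_seq; apply/seteqP; split => X /= BX i; first by move=> _.
    by apply: BX; rewrite /= mem_index_enum.
  apply: bigsetI_measurable => i _.
  by rewrite -[X in measurable X]setTI; exact: measurable_tnth.
rewrite big_ord_recl -IHn//= -product_measure1E//; last first.
  by apply: (mbox _ (fun i => A (lift ord0 i))) => i; exact: mA.
rewrite /distribution /pushforward; congr (_ _).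
apply/seteqP; split => -[x X] /=.
  move=> h; split; first by have := h ord0; rewrite tnth0.
  by move=> i; have := h (lift ord0 i); rewrite tnthS.
case=> hx hX i; case: (unliftP ord0 i) => [j|] ->; last by rewrite tnth0.
by rewrite tnthS; exact: hX.
Qed.

End power_measure.

Section affine.
Context (R : realType) (H : normedModType R).

Definition lin_indep (d : nat) (v : 'I_d -> H) : Prop :=
  forall c : 'I_d -> R, \sum_(i < d) c i *: v i = 0 -> forall i, c i = 0.

Definition dim_ge (d : nat) : Prop := exists v : 'I_d -> H, lin_indep v.

Definition AG (d : nat) : set (set H) :=
  [set L | exists a (v : 'I_d -> H), lin_indep v /\
    L = [set a + \sum_(i < d) c i *: v i | c in [set: 'I_d -> R]]].

Definition dist (x : H) (L : set H) : R := inf [set `|x - y| | y in L].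

(* An infimum of nonnegative extended reals, so that no integrability
   assumption is hidden in the definition. *)
Definition e2 (mu : {measure set (borel H) -> \bar R}) (d : nat) : \bar R :=
  ereal_inf [set sqrte (\int[mu]_x (dist x L ^+ 2)%:E)%E | L in AG d].

(* The infimum is a minimum (it is attained) as soon as AG d is nonempty,
   because only the finitely many points of X matter. *)
Definition c_dls (d : nat) (X : d.+2.-tuple H) : R :=
  inf [set Num.sqrt ((\sum_(i < d.+2) dist (tnth X i) L ^+ 2) / d.+2%:R)
      | L in AG d].

End affine.

(* Main.v *)
Require Import Defs.
From HB Require Import structures.
From mathcomp Require Import all_boot all_order all_algebra.
From mathcomp Require Import all_classical all_reals all_analysis.
From mathcomp Require Import measurable_realfun.

Set Implicit Arguments.
Unset Strict Implicit.
Unset Printing Implicit Defensive.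

Import Order.TTheory GRing.Theory Num.Theory.
Import numFieldNormedType.Exports.
Local Open Scope classical_set_scope.
Local Open Scope ring_scope.

(* For a fixed L the mean of the squared distances from the points of X to L
   dominates the square of c_dls X, and integrates to the mu-integral of the
   squared distance to L because each coordinate of X has law mu. Then take the
   infimum over L. *)

(* [ge0_le_integral] asks both functions to be measurable; the integral of a
   nonnegative function is a supremum over the simple functions below it, so
   that monotonicity holds regardless, and c_dls need not be measurable. *)
Lemma ge0_le_integralT d (T : measurableType d) (R : realType)
    (mu : {measure set T -> \bar R}) (f g : T -> \bar R) :
  (forall x, 0 <= f x)%E -> (forall x, f x <= g x)%E ->
  (\int[mu]_x f x <= \int[mu]_x g x)%E.
Proof.
move=> f0 fg; have g0 x : (0 <= g x)%E by exact: le_trans (f0 x) (fg x).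
rewrite !ge0_integralTE//; apply: le_ereal_sup => _ [h hf <-].
by exists h => // x; exact: le_trans (hf x) (fg x).
Qed.

Section dist.
Context (R : realType) (H : normedModType R).
Implicit Types L : set H.

Lemma dist_lbound (x : H) L : has_lbound [set `|x - y| | y in L].
Proof. by exists 0 => _ [y _ <-]. Qed.

(** An infimum is below [a] as soon as one of its members is. The strict sublevel sets are thus
    unions of open balls, hence open, which makes [dist] Borel. An empty [L] is excluded because
    [inf set0] is 0. *)
Lemma dist_ltE L (a : R) : L !=set0 ->
  [set x | dist x L < a] = \bigcup_(y in L) ball y a.
Proof.
move=> [y0 Ly0]; apply/seteqP; split => x /=.
  have ne : [set `|x - y| | y in L] !=set0 by exists `|x - y0|, y0.
  move=> /(inf_lt ne)[_ [y Ly <-] ya].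
  by exists y => //; rewrite -ball_normE /= distrC.
case=> y Ly; rewrite -ball_normE /= distrC; apply: le_lt_trans.
by apply: ge_inf; [exact: dist_lbound|exists y].
Qed.

Lemma measurable_dist L : L !=set0 ->
  measurable_fun setT (fun x : borel H => dist x L : R).
Proof.
move=> L0; apply: (measurability _ (RGenInftyO.measurableE R)).
move=> _ [_ [a ->] <-]; apply: measurableI => //.
have -> : (fun x : borel H => dist x L) @^-1` `]-oo, a[%classic =
          [set x | dist x L < a].
  by apply/seteqP; split => x /=; rewrite in_itv.
rewrite dist_ltE//; apply: sub_sigma_algebra.
by apply: bigcup_open => y _; exact: ball_open.
Qed.

Lemma AG_nonempty d L : AG d L -> L !=set0.
Proof.
by move=> [a [v [_ ->]]]; exists (a + \sum_(i < d) 0 *: v i), (fun=> 0).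
Qed.

Lemma c_dls_ge0 d (X : d.+2.-tuple H) : 0 <= c_dls X.
Proof.
rewrite /c_dls; set E := [set _ | _ in _].
(* [AG d] may be empty here, as no dimension bound is assumed; [inf] then takes its default value
   0. *)
have [->|/set0P E0] := eqVneq E set0; first by rewrite inf0.
by apply: lb_le_inf => // _ [L _ <-]; exact: sqrtr_ge0.
Qed.

Lemma c_dls_sqr_le d (X : d.+2.-tuple H) L : AG d L ->
  c_dls X ^+ 2 <= (\sum_(i < d.+2) dist (tnth X i) L ^+ 2) / d.+2%:R.
Proof.
move=> AL.
have S0 : 0 <= (\sum_(i < d.+2) dist (tnth X i) L ^+ 2) / d.+2%:R.
  by rewrite divr_ge0// sumr_ge0// => i _; exact: sqr_ge0.
rewrite -(sqr_sqrtr S0) lerXn2r ?nnegrE ?sqrtr_ge0 ?c_dls_ge0//.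
apply: ge_inf; last by exists L.
by exists 0 => _ [M _ <-]; exact: sqrtr_ge0.
Qed.

End dist.

Section marginals.
Context d (T : measurableType d) (R : realType) (P : probability T R).
Local Open Scope ereal_scope.

(** The preimage of [A] is a box whose sides other than the [i]-th are [setT], each contributing a
    factor 1. *)
Lemma power_measure_tnth n (i : 'I_n) (A : set T) : measurable A ->
  pushforward (power_measure P n) ((@tnth n T)^~ i) A = P A.
Proof.
move=> mA; rewrite /pushforward.
pose B j := if j == i then A else setT.
have -> : (@tnth n T)^~ i @^-1` A = [set X | forall j, B j (tnth X j)].
  apply/seteqP; split => X /=; last by move=> /(_ i); rewrite /B eqxx.
  by move=> AX j; rewrite /B; case: eqP => // ->.
rewrite power_measure_box; last by move=> j; rewrite /B; case: ifP.
rewrite (bigD1 i)//= big1 ?mule1 /B ?eqxx// => j /negPf ->.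
exact: probability_setT.
Qed.

Lemma integral_power_measure_tnth n (i : 'I_n) (f : T -> \bar R) :
  measurable_fun setT f -> (forall x, 0 <= f x) ->
  \int[power_measure P n]_X f (tnth X i) = \int[P]_x f x.
Proof.
move=> mf f0.
rewrite -(@ge0_integral_pushforward _ _ _ _ _ _ (measurable_tnth i) _ setT)//.
apply: eq_measure_integral => [|mtnth A mA _]; first exact: measurable_tnth.
exact: power_measure_tnth.
Qed.

End marginals.

Lemma integral_c_dls_sqr_le (R : realType) (H : normedModType R) (d : nat)
    (mu : probability (borel H) R) (L : set H) : AG d L ->
  (\int[power_measure mu d.+2]_X (c_dls X ^+ 2)%:E <=
   \int[mu]_x (dist x L ^+ 2)%:E)%E.
Proof.
move=> AL; pose f (x : borel H) := (dist x L ^+ 2)%:E : \bar R.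
have f0 x : (0 <= f x)%E by rewrite lee_fin sqr_ge0.
have mf : measurable_fun setT f.
  apply/measurable_EFinP; apply: measurable_funX.
  exact: measurable_dist (AG_nonempty AL).
have mft (i : 'I_d.+2) :
    measurable_fun setT (fun X : d.+2.-tuple (borel H) => f (tnth X i)).
  exact: measurableT_comp mf (measurable_tnth i).
have -> : (\int[mu]_x (dist x L ^+ 2)%:E =
    \int[power_measure mu d.+2]_X
       ((d.+2%:R^-1)%:E * \sum_(i < d.+2) f (tnth X i)))%E.
  rewrite ge0_integralZl ?lee_fin ?invr_ge0//; last 2 first.
  - exact: emeasurable_sum.
  - by move=> X _; exact: sume_ge0.
  rewrite ge0_integral_sum//.
  (* The [d.+2] summands now have the same integral, so the factor [d.+2%:R^-1] cancels their
     number, even if that integral is [+oo]. *)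
  under eq_bigr do rewrite integral_power_measure_tnth//.
  have natmulE (x : \bar R) n : (x *+ n)%R = (n%:R%:E * x)%E.
    by rewrite mule_natl.
  by rewrite sumr_const card_ord natmulE muleA -EFinM mulVf ?mul1e.
apply: ge0_le_integralT => X.
  by rewrite lee_fin sqr_ge0.
by rewrite sumEFin -EFinM lee_fin mulrC c_dls_sqr_le.
Qed.

Theorem proposition6p1 (R : realType) (H : completeNormedModType R)
    (ip : {dot H for idfun}) (ip_norm : forall x : H, ip x x = `|x| ^+ 2)
    (H_separable : separable H)
    (d : nat) (d_ge1 : (1 <= d)%N) (H_dim : dim_ge H d)
    (mu : probability (borel H) R)
    (mu_bounded : bounded_set (support_of mu)) :
  (\int[power_measure mu d.+2]_X (c_dls X ^+ 2)%:E <= e2 mu d ^+ 2)%E.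
Proof.
have c0 : (0 <= \int[power_measure mu d.+2]_X (c_dls X ^+ 2)%:E)%E.
  by apply: integral_ge0 => X _; rewrite lee_fin sqr_ge0.
have e0 : (0 <= e2 mu d)%E by apply/ereal_infP => _ [L _ <-]; exact: sqrte_ge0.
(* Since [e2] is an infimum of square roots, taking the root of the left side leaves a bound to be
   checked for each [L] separately. *)
rewrite -(sqr_sqrte c0) lee_sqr ?sqrte_ge0//.
apply/ereal_infP => _ [L AL <-].
rewrite lee_sqrt; first exact: integral_c_dls_sqr_le.
by apply: integral_ge0 => x _; rewrite lee_fin sqr_ge0.
Qed.
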